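(* Let $p$ be an odd prime, $0\le m\le p-2$, $a\in\mathbb Z_p^\times$, $c\in p\mathbb Z_p$. Write $K_{a,c,m}(z,w)=\sum_{i,j\ge0}\alpha_{ij}z^iw^j$. Then $K_{a,c,m}(z,w)\in S_z\hat\otimes\mathbb Z_p\langle w\rangle$; that is, writing $K_{a,c,m}=\sum_j T_j(z)w^j$, each $T_j(z)$ lies in $S_z$, equivalently all $\alpha_{ij}\in\mathbb Z_p$ with $\mathrm{ord}_p(\alpha_{ij})\ge i\,c_p$.
   Context: $c_p=1-\frac1{p-1}=\frac{p-2}{p-1}$. For a variable $x$, $S_x=\{\sum_n a_nx^n\in\mathbb Q_p\langle x\rangle:\ \mathrm{ord}_p(a_n)\ge n c_p\ \forall n\}$. Fix a topological generator $\gamma$ of $1+p\mathbb Z_p$, let $\omega$ be the Teichmüller character, $\log_\gamma=\log/\log\gamma$, and $K_{a,c,m}(z,w)=\omega(a)^m\sum_{n\ge0}\binom{\log_\gamma((a+cz)/\omega(a))}{n}(pw)^n$. *)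

(* Defs.v *)
From HB Require Import structures.
From mathcomp Require Import all_boot all_order all_algebra.
From mathcomp Require Import boolp classical_sets constructive_ereal.
From mathcomp Require Import generic_quotient cyclic.

Set Implicit Arguments.
Unset Strict Implicit.
Unset Printing Implicit Defensive.

Import Order.TTheory GRing.Theory Num.Theory.
Local Open Scope quotient_scope.
Local Open Scope ring_scope.

(* Z_p as the inverse limit of the Z/p^n: [x n] is the residue of x modulo    *)
(* p^n in {0, ..., p^n - 1} (the bound follows from the compatibility).       *)
Record padic_int (p : nat) (pP : prime p) := PadicInt {
  residue :> nat -> nat;
  residueP : forall n, (residue n.+1 %% p ^ n)%N = residue n }.

Section PadicIntRing.
Context (p : nat) (pP : prime p).
Local Notation Zp := (padic_int pP).

Lemma padic_int_eq (x y : Zp) : (forall n, x n = y n) -> x = y.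
Proof.
case: x y => [x hx] [y hy] /= exy; have {exy}exy : x = y by apply/funext.
by subst y; congr PadicInt; exact: Prop_irrelevance.
Qed.

Lemma residue_mod (x : Zp) n : (x n %% p ^ n)%N = x n.
Proof. by rewrite -residueP modn_mod. Qed.

Lemma residue_le (x : Zp) m n : (m <= n)%N -> (x n %% p ^ m)%N = x m.
Proof.
move=> /subnKC <-; elim: (n - m)%N => [|k IH]; first by rewrite addn0 residue_mod.
rewrite addnS -IH -(residueP x (m + k)) modn_dvdm //.
by rewrite dvdn_exp2l // leq_addr.
Qed.

Lemma natr_subproof k n : (k %% p ^ n.+1 %% p ^ n)%N = (k %% p ^ n)%N.
Proof. by rewrite modn_dvdm // dvdn_exp2l. Qed.
Definition padic_nat k : Zp := PadicInt pP (natr_subproof k).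

Lemma add_subproof (x y : Zp) n :
  ((x n.+1 + y n.+1) %% p ^ n.+1 %% p ^ n)%N = ((x n + y n) %% p ^ n)%N.
Proof. by rewrite natr_subproof -modnDm !residueP. Qed.
Definition padic_add x y : Zp := PadicInt pP (add_subproof x y).

Lemma mul_subproof (x y : Zp) n :
  ((x n.+1 * y n.+1) %% p ^ n.+1 %% p ^ n)%N = ((x n * y n) %% p ^ n)%N.
Proof. by rewrite natr_subproof -modnMm !residueP. Qed.
Definition padic_mul x y : Zp := PadicInt pP (mul_subproof x y).

Lemma residue_lt (x : Zp) n : (x n < p ^ n)%N.
Proof. by rewrite -residue_mod ltn_pmod // expn_gt0 prime_gt0. Qed.

Lemma opp_subproof (x : Zp) n :
  ((p ^ n.+1 - x n.+1) %% p ^ n.+1 %% p ^ n)%N = ((p ^ n - x n) %% p ^ n)%N.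
Proof.
rewrite natr_subproof; apply/eqP; rewrite -(eqn_modDr (x n.+1)).
rewrite subnK ?(ltnW (residue_lt _ _)) // -modnDmr residueP subnK.
  by rewrite modnn expnS modnMl.
exact: ltnW (residue_lt _ _).
Qed.
Definition padic_opp x : Zp := PadicInt pP (opp_subproof x).

HB.instance Definition _ := gen_eqMixin Zp.
HB.instance Definition _ := gen_choiceMixin Zp.

Lemma padic_addA : associative padic_add.
Proof.
by move=> x y z; apply: padic_int_eq => n /=; rewrite modnDml modnDmr addnA.
Qed.
Lemma padic_addC : commutative padic_add.
Proof. by move=> x y; apply: padic_int_eq => n /=; rewrite addnC. Qed.
Lemma padic_add0 : left_id (padic_nat 0) padic_add.
Proof. by move=> x; apply: padic_int_eq => n /=; rewrite mod0n residue_mod. Qed.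
Lemma padic_addN : left_inverse (padic_nat 0) padic_opp padic_add.
Proof.
move=> x; apply: padic_int_eq => n /=; rewrite modnDml subnK ?mod0n ?modnn //.
exact: ltnW (residue_lt _ _).
Qed.
HB.instance Definition _ :=
  GRing.isZmodule.Build Zp padic_addA padic_addC padic_add0 padic_addN.

Lemma padic_mulA : associative padic_mul.
Proof.
by move=> x y z; apply: padic_int_eq => n /=; rewrite modnMml modnMmr mulnA.
Qed.
Lemma padic_mulC : commutative padic_mul.
Proof. by move=> x y; apply: padic_int_eq => n /=; rewrite mulnC. Qed.
Lemma padic_mul1 : left_id (padic_nat 1) padic_mul.
Proof.
by move=> x; apply: padic_int_eq => n /=; rewrite modnMml mul1n residue_mod.
Qed.
Lemma padic_mulD : left_distributive padic_mul padic_add.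
Proof.
by move=> x y z; apply: padic_int_eq => n /=; rewrite modnMml modnDm mulnDl.
Qed.
Lemma padic_1neq0 : padic_nat 1 != padic_nat 0.
Proof.
apply/eqP => /(congr1 (fun x : Zp => x 1%N)) /=.
by rewrite expn1 mod0n modn_small // prime_gt1.
Qed.
HB.instance Definition _ := GRing.Zmodule_isComNzRing.Build Zp
  padic_mulA padic_mulC padic_mul1 padic_mulD padic_1neq0.

Definition padic_unit : pred Zp := fun x => `[< exists y, y * x = 1 >].
Definition padic_inv (x : Zp) : Zp :=
  if pselect (exists y, y * x = 1) is left h then projT1 (cid h) else x.

Lemma padic_mulV : {in padic_unit, left_inverse 1 padic_inv *%R}.
Proof.
move=> x /asboolP h; rewrite /padic_inv; case: pselect => // h'.
by case: cid.
Qed.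
Lemma padic_unitP (x y : Zp) : y * x = 1 -> padic_unit x.
Proof. by move=> h; apply/asboolP; exists y. Qed.
Lemma padic_inv_out : {in [predC padic_unit], padic_inv =1 id}.
Proof.
move=> x /negP nu; rewrite /padic_inv; case: pselect => // h.
by case: nu; apply/asboolP.
Qed.
HB.instance Definition _ := GRing.ComNzRing_hasMulInverse.Build Zp
  padic_mulV padic_unitP padic_inv_out.

Lemma padic_neq0 (x : Zp) : x != 0 -> exists n, x n.+1 != 0%N.
Proof.
move=> /eqP x0; apply: contrapT => /forallNP h; apply: x0.
apply: padic_int_eq => n; rewrite /= mod0n; have /negP := h n.
rewrite negbK => /eqP xn; rewrite -residueP xn mod0n //.
Qed.

(* The order of a nonzero x is the least n such that x <> 0 modulo p^(n+1).   *)
Definition padic_int_ord (x : Zp) : nat :=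
  if pselect (exists n, x n.+1 != 0%N) is left h then ex_minn h else 0%N.

Lemma padic_int_ordP (x : Zp) k : x != 0 -> (x k == 0%N) = (k <= padic_int_ord x)%N.
Proof.
move=> /padic_neq0 h0; rewrite /padic_int_ord; case: pselect => // h.
case: ex_minnP => n xn nmin; apply/idP/idP => [xk|kn].
  rewrite leqNgt; apply: contra xn => nk.
  by rewrite -(residue_le x nk) (eqP xk) mod0n.
case: k kn => [|k] kn; first by rewrite -leqn0 -ltnS residue_lt.
by apply/negPn/negP => /nmin; rewrite leqNgt kn.
Qed.

Lemma logn_residue (x : Zp) N : x != 0 -> (padic_int_ord x < N)%N ->
  (0 < x N)%N /\ logn p (x N) = padic_int_ord x.
Proof.
move=> x0 oN; have xN : (0 < x N)%N by rewrite lt0n padic_int_ordP // -ltnNge.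
split=> //; apply/eqP; rewrite eqn_leq leqNgt -!pfactor_dvdn //.
by rewrite /dvdn !residue_le ?(ltnW oN) // !padic_int_ordP // ltnn leqnn.
Qed.

Lemma padic_int_ordM (x y : Zp) : x != 0 -> y != 0 ->
  x * y != 0 /\ padic_int_ord (x * y) = (padic_int_ord x + padic_int_ord y)%N.
Proof.
move=> x0 y0; set N := (padic_int_ord x + padic_int_ord y).+1.
have [xN lx] : (0 < x N)%N /\ logn p (x N) = padic_int_ord x.
  by apply: logn_residue => //; rewrite ltnS leq_addr.
have [yN ly] : (0 < y N)%N /\ logn p (y N) = padic_int_ord y.
  by apply: logn_residue => //; rewrite ltnS leq_addl.
have xyE k : (k <= N)%N ->
    ((x * y) k == 0%N) = (k <= padic_int_ord x + padic_int_ord y)%N.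
  move=> kN; have -> : (x * y) k = ((x N * y N) %% p ^ k)%N.
    by rewrite -modnMm !residue_le.
  by rewrite -/(dvdn _ _) pfactor_dvdn ?muln_gt0 ?xN // lognM // lx ly.
have xy0 : x * y != 0.
  apply/eqP => h; have := xyE N (leqnn N).
  by rewrite h /= mod0n eqxx ltnn.
split=> //; apply/eqP; rewrite eqn_leq leqNgt.
by rewrite -!(padic_int_ordP _ xy0) !xyE ?leqnn ?ltnn // /N.
Qed.

Lemma padic_mulf_eq0 (x y : Zp) : x * y = 0 -> (x == 0) || (y == 0).
Proof.
move=> xy0; rewrite -[_ || _]negbK negb_or; apply/negP => /andP[x0 y0].
by have [] := padic_int_ordM x0 y0; rewrite xy0 eqxx.
Qed.
HB.instance Definition _ :=
  GRing.ComUnitRing_isIntegral.Build Zp padic_mulf_eq0.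

End PadicIntRing.

Notation padic pP := {fraction (padic_int pP)}.
Notation "x %:F" := (@FracField.tofrac _ x) : ring_scope.

Section PadicOrd.
Context (p : nat) (pP : prime p).
Local Notation Zp := (padic_int pP).
Local Notation Qp := (padic pP).

Definition padic_ord (x : Qp) : \bar rat :=
  if x == 0 then +oo%E else
  ((padic_int_ord (\n_(repr x)))%:R - (padic_int_ord (\d_(repr x)))%:R)%:E.

Lemma padic_ord_frac (x y : Zp) : x != 0 -> y != 0 ->
  padic_ord (x%:F / y%:F) = ((padic_int_ord x)%:R - (padic_int_ord y)%:R)%:E.
Proof.
move=> x0 y0; rewrite /padic_ord mulf_eq0 invr_eq0 !tofrac_eq0.
rewrite (negPf x0) (negPf y0) /=; set q := _ / _; congr (_%:E).
have q0 : q != 0 by rewrite mulf_neq0 ?invr_eq0 ?tofrac_eq0.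
set n := \n_(repr q); set d := \d_(repr q).
have d0 : d != 0 by exact: denom_ratioP.
have qE : q = n%:F / d%:F.
  rewrite -[LHS]reprK /n /d; case: (repr q) => -[u v] /= v0.
  apply: (canRL (mulfK _)); first by rewrite tofrac_eq0.
  unlock FracField.tofrac; rewrite -[LHS]FracField.pi_mul.
  apply/eqmodP; rewrite /= FracField.equivfE /FracField.mulf.
  by rewrite !numden_Ratio ?mulf_neq0 ?oner_neq0 //= !mulr1 mulrC.
have n0 : n != 0 by apply: contra_neq q0 => n0; rewrite qE n0 tofrac0 mul0r.
have xdny : x * d = n * y.
  apply/eqP; rewrite -tofrac_eq !tofracM; apply/eqP.
  have /eqP : x%:F / y%:F = n%:F / d%:F by rewrite -qE.
  by rewrite eqr_div ?tofrac_eq0 // => /eqP.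
have [_ e1] := padic_int_ordM x0 d0; have [_ e2] := padic_int_ordM n0 y0.
move: e1; rewrite xdny e2 => /(congr1 (fun k => k%:R : rat)); rewrite !natrD => e.
by apply/eqP; rewrite subr_eq addrAC -e addrK.
Qed.
End PadicOrd.

Section PadicIntFacts.
Context (p : nat) (pP : prime p).
Local Notation Zp := (padic_int pP).

Lemma residueD (x y : Zp) n : (x + y) n = ((x n + y n) %% p ^ n)%N.
Proof. by []. Qed.

Lemma residueM (x y : Zp) n : (x * y) n = ((x n * y n) %% p ^ n)%N.
Proof. by []. Qed.

Lemma residue_natr k n : (k%:R : Zp) n = (k %% p ^ n)%N.
Proof.
elim: k => [//|k IH]; rewrite mulrSr.
by rewrite residueD IH modnDm addn1.
Qed.

Lemma residueX (x : Zp) k n : (x ^+ k) n = (x n ^ k %% p ^ n)%N.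
Proof.
elim: k => [//|k IH]; rewrite exprS expnS.
by rewrite residueM IH modnMmr.
Qed.

Lemma padic_dvdP (x : Zp) n : (exists y, x = p%:R ^+ n * y) <-> x n = 0%N.
Proof.
split=> [[y ->]|xn].
  rewrite residueM -natrX residue_natr.
  by rewrite modnn mul0n mod0n.
have hy k : ((x (n + k.+1) %/ p ^ n) %% p ^ k)%N = (x (n + k) %/ p ^ n)%N.
  by rewrite modn_divl -expnD addnS addnC -(residueP x (k + n)) addnC.
exists (PadicInt pP hy); apply: padic_int_eq => k.
rewrite residueM -natrX residue_natr /= modnMml mulnC divnK ?residue_le ?leq_addl //.
by rewrite /dvdn residue_le ?leq_addr // xn.
Qed.

Lemma unit_residue (x : Zp) : x \is a GRing.unit -> coprime (x 1%N) p.
Proof.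
move=> /divrr h; rewrite coprime_sym prime_coprime //.
apply/negP => /dvdnP[k xk].
have := congr1 (fun z : Zp => z 1%N) h.
rewrite residueM xk expn1 mulnAC modnMl.
by rewrite -[RHS]/(1 %% p ^ 1)%N expn1 modn_small // prime_gt1.
Qed.

(* omega(a) : the (p-1)-st root of unity congruent to a modulo p.             *)
Definition teichmuller (a : Zp) : Zp :=
  xget 0 [set w : Zp | w ^+ p.-1 = 1 /\ w 1%N = a 1%N]%classic.

Lemma teichmullerP (a : Zp) : a \is a GRing.unit ->
  teichmuller a ^+ p.-1 = 1 /\ (teichmuller a) 1%N = a 1%N.
Proof.
move=> /unit_residue a1; rewrite /teichmuller.
case: xgetP => [w _ //|/(_ _) none]; exfalso.
have an n : coprime (a n.+1) (p ^ n.+1).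
  have e : (a n.+1 %% p)%N = a 1%N by rewrite -(residue_le a (ltn0Sn n)) expn1.
  by rewrite coprime_pexpr // coprime_sym -coprime_modr e coprime_sym.
have euler n : (a n.+1 ^ (p ^ n * p.-1) = 1 %[mod p ^ n.+1])%N.
  by rewrite mulnC -(totient_pfactor pP (ltn0Sn n)) Euler_exp_totient.
have euler' n : (a n.+1 ^ (p ^ n.+1 * p.-1) = 1 %[mod p ^ n.+1])%N.
  have -> : (p ^ n.+1 * p.-1 = p ^ n * p.-1 * p)%N by rewrite expnSr mulnAC.
  by rewrite expnM -modnXm euler modnXm exp1n.
have hw n : ((a n.+1 ^ (p ^ n.+1) %% p ^ n.+1) %% p ^ n)%N
            = (a n ^ (p ^ n) %% p ^ n)%N.
  rewrite modn_dvdm ?dvdn_exp2l // -modnXm residueP.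
  case: n => [|n]; first by rewrite !modn1.
  have -> : (p ^ n.+2 = p ^ n.+1 * p.-1 + p ^ n.+1)%N.
    by rewrite -mulnSr prednK ?prime_gt0 // expnSr.
  by rewrite expnD -modnMml euler' modnMml mul1n.
apply: (none (PadicInt pP hw)); split.
  apply: padic_int_eq => -[|n]; rewrite residueX //= ?modn1 //.
  by rewrite modnXm -expnM euler'.
rewrite /= expn1; have := euler 0%N; rewrite expn0 mul1n expn1 => h.
have : (a 1%N ^ p.-1.+1 %% p)%N = a 1%N.
  by rewrite expnS -modnMmr h modnMmr muln1 -[RHS](residue_mod a) expn1.
by rewrite prednK ?prime_gt0.
Qed.

Lemma teichmuller_uniq (w w' : Zp) : w ^+ p.-1 = 1 -> w' ^+ p.-1 = 1 ->
  w 1%N = w' 1%N -> w = w'.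
Proof.
have p1 : (0 < p.-1)%N by rewrite -subn1 subn_gt0 prime_gt1.
move=> h h' e; apply/eqP; rewrite -subr_eq0.
have /eqP : w ^+ p.-1 - w' ^+ p.-1 = 0 by rewrite h h' subrr.
rewrite subrXX mulf_eq0 => /orP[//|/eqP s0]; exfalso.
have uw : coprime (w 1%N) p.
  apply: unit_residue; rewrite -(unitrX_pos _ p1) h; exact: unitr1.
have : (\sum_(i < p.-1) w ^+ (p.-1.-1 - i) * w' ^+ i) 1%N
       = (p.-1 * w 1%N ^ p.-1.-1 %% p ^ 1)%N.
  have eqt i : (i < p.-1)%N ->
      (w ^+ (p.-1.-1 - i) * w' ^+ i) 1%N = (w 1%N ^ p.-1.-1 %% p ^ 1)%N.
    move=> ip; rewrite residueM.
    by rewrite !residueX -e modnMm -expnD subnK // -ltnS prednK.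
  have : forall k, (k <= p.-1)%N ->
     (\sum_(0 <= i < k) w ^+ (p.-1.-1 - i) * w' ^+ i) 1%N
       = (k * w 1%N ^ p.-1.-1 %% p ^ 1)%N.
    elim=> [|k IH] kp; first by rewrite big_geq ?mul0n.
    by rewrite big_nat_recr // residueD (IH (ltnW kp)) eqt // modnDm mulSnr.
  by move/(_ _ (leqnn _)); rewrite big_mkord.
rewrite s0 -[LHS]/(0 %% p ^ 1)%N mod0n expn1 => /esym/eqP.
rewrite -/(dvdn _ _) Euclid_dvdM // Euclid_dvdX // => /orP[|/andP[]].
  by rewrite gtnNdvd // ltn_predL prime_gt0.
by move: uw; rewrite coprime_sym prime_coprime // => /negPf ->.
Qed.
End PadicIntFacts.

Section Kernel.
Context (p : nat) (pP : prime p).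
Local Notation Zp := (padic_int pP).
Local Notation Qp := (padic pP).

Definition ord_ge (x : Qp) (r : rat) : Prop := (r%:E <= padic_ord x)%E.

Definition in_pZp (x : Zp) : Prop := exists y, x = p%:R * y.

(* gamma topologically generates 1 + p Z_p: its powers lie in 1 + p Z_p and   *)
(* meet every class of 1 + p Z_p modulo every p^n.                            *)
Definition topological_generator (gamma : Zp) : Prop :=
  in_pZp (gamma - 1) /\
  forall x : Zp, in_pZp (x - 1) ->
  forall n : nat, exists k : int, (gamma ^ k) n = x n.

Definition is_padic_int (x : Qp) : Prop := exists y : Zp, x = y%:F.

Definition padic_cvg (u : nat -> Qp) (l : Qp) : Prop :=
  forall B : nat, exists N, forall n, (N <= n)%N ->
    ord_ge (u n - l) B%:R.

Definition padic_log (x : Qp) : Qp :=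
  xget 0 [set l | padic_cvg
    (fun n => \sum_(1 <= k < n) (-1) ^+ k.+1 / k%:R * (x - 1) ^+ k) l]%classic.

(* A power series sum_n f_n x^n over Q_p is its coefficient sequence f.       *)
Local Notation series := (nat -> Qp).

(* Membership in the Tate algebra Q_p<x>.                                     *)
Definition is_tate (f : series) : Prop := padic_cvg f 0.

(* Convergence of polynomials for the Gauss norm of Q_p<x>.                   *)
Definition gauss_cvg (u : nat -> {poly Qp}) (l : series) : Prop :=
  forall B : nat, exists N, forall n, (N <= n)%N ->
  forall i, ord_ge ((u n)`_i - l i) B%:R.

Definition tate_log (f : {poly Qp}) : series :=
  xget (fun=> 0) [set l | is_tate l /\ gauss_cvg
    (fun n => \sum_(1 <= k < n) ((-1) ^+ k.+1 / k%:R) *: (f - 1) ^+ k) l]%classic.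

Definition series_const (x : Qp) : series := fun i => if i == 0%N then x else 0.

Definition series_mul (f g : series) : series :=
  fun n => \sum_(i < n.+1) f i * g (n - i)%N.

(* binom(f, n) = f (f - 1) ... (f - n + 1) / n!                               *)
Definition series_binom (f : series) (n : nat) : series := fun i =>
  (\big[series_mul/series_const 1]_(k < n)
     (fun i' => f i' - series_const k%:R i')) i / n`!%:R.

(* log_gamma ((a + c z) / omega(a)) as a power series in z.                   *)
Definition log_gamma_series (gamma a c : Zp) : series := fun i =>
  tate_log ((teichmuller a)%:F^-1 *: (a%:F%:P + c%:F *: 'X)) i
    / padic_log gamma%:F.

(* The coefficient alpha_ij of z^i w^j in K_{a,c,m}(z, w).                    *)
Definition K_coef (gamma a c : Zp) (m : nat) (i j : nat) : Qp :=
  (teichmuller a)%:F ^+ m *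
    (series_binom (log_gamma_series gamma a c) j i * p%:R ^+ j).

Definition c_ : rat := 1 - (p%:R - 1)^-1.

Definition in_S (f : series) : Prop :=
  is_tate f /\ forall n, ord_ge (f n) (n%:R * c_).

Definition in_Zp_tate (f : series) : Prop :=
  is_tate f /\ forall n, is_padic_int (f n).

(* S_z (x)^ Z_p<w>, for the Gauss norm: the series sum_ij F_ij z^i w^j that   *)
(* are uniform limits of finite sums sum_k s_k(z) t_k(w) with s_k in S_z and  *)
(* t_k in Z_p<w>.  (The p-adic topology of S_z is strictly finer than the     *)
(* Gauss norm topology, as p S_z is not open in S_z for the latter.)          *)
Definition in_S_tensor_Zp (F : nat -> nat -> Qp) : Prop :=
  forall B : nat, exists (r : nat) (s t : 'I_r -> series),
    [/\ forall k, in_S (s k), forall k, in_Zp_tate (t k) &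
        forall i j, ord_ge (F i j - \sum_(k < r) s k i * t k j) B%:R].

End Kernel.

Arguments c_ p : clear implicits.

(* Main.v *)
Require Import Defs.
From mathcomp Require Import all_boot all_order all_algebra.
From mathcomp Require Import boolp classical_sets constructive_ereal.
From mathcomp Require Import generic_quotient cyclic ring lra zify.
Import Order.TTheory GRing.Theory Num.Theory.
Local Open Scope quotient_scope.
Local Open Scope ring_scope.

(** Let [c_p = (p - 2) / (p - 1)].  For [f] in [1 + p Z_p + p z Z_p], the
    coefficient of [z^i] in [(f - 1)^k / k], for [1 <= i <= k], has order at
    least [k - ord(i)] because [C(k, i) / k = C(k - 1, i - 1) / i]; since
    [ord(i) <= (i - 1) / (p - 1)], the coefficient of [z^i] in [log f] has order
    at least [(i - 1) c_p + 1].  Dividing by [log gamma], of order [1], leaves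
    [(i - 1) c_p], so each factor of [binom(L, j)] costs at most [c_p], and
    [j!] costs at most [j / (p - 1)]: together at most [j], which [p^j] pays.
    Counting the factors of [binom(L, j)] as merely integral gives instead
    order at least [j c_p], uniformly in [i], hence the tensor statement. *)

(** * Valuation properties of the order on Q_p *)

Section PadicOrdTheory.
Set Implicit Arguments.
Unset Strict Implicit.
Context (p : nat) (pP : prime p).
Local Notation Zp := (padic_int pP).
Local Notation Qp := (padic pP).
Implicit Types (x y : Qp) (r s : rat).

Lemma padic_fracP x : exists n d : Zp, d != 0 /\ x = n%:F / d%:F.
Proof.
exists (\n_(repr x)), (\d_(repr x)); split; first exact: denom_ratioP.
rewrite -[LHS]reprK; case: (repr x) => -[u v] /= v0.
apply: (canRL (mulfK _)); first by rewrite tofrac_eq0.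
unlock FracField.tofrac; rewrite -[LHS]FracField.pi_mul.
apply/eqmodP; rewrite /= FracField.equivfE /FracField.mulf.
by rewrite !numden_Ratio ?mulf_neq0 ?oner_neq0 //= !mulr1 mulrC.
Qed.

Lemma ord_ge_frac (n d : Zp) r : n != 0 -> d != 0 ->
  ord_ge (n%:F / d%:F) r <->
    r <= (padic_int_ord n)%:R - (padic_int_ord d)%:R.
Proof. by move=> n0 d0; rewrite /ord_ge padic_ord_frac. Qed.

Lemma ord_ge_zero r : ord_ge (0 : Qp) r.
Proof. by rewrite /ord_ge /padic_ord eqxx leey. Qed.

Lemma ord_ge_le x r s : s <= r -> ord_ge x r -> ord_ge x s.
Proof. by move=> sr; apply: le_trans; rewrite lee_fin. Qed.

Lemma padic_int_ordD (n m : Zp) : n != 0 -> m != 0 -> n + m != 0 ->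
  (minn (padic_int_ord n) (padic_int_ord m) <= padic_int_ord (n + m)%R)%N.
Proof.
move=> n0 m0 nm0; set k := minn _ _.
have nk : n k = 0%N by apply/eqP; rewrite padic_int_ordP // geq_minl.
have mk : m k = 0%N by apply/eqP; rewrite padic_int_ordP // geq_minr.
by rewrite -padic_int_ordP // residueD nk mk mod0n.
Qed.

(** Over a common denominator this reduces to the ultrametric inequality for the numerators. Zeros
    are split off because [padic_int_ord] gives 0 the junk value 0. *)
Lemma ord_geD x y r : ord_ge x r -> ord_ge y r -> ord_ge (x + y) r.
Proof.
have [->|x0] := eqVneq x 0; first by rewrite add0r.
have [->|y0] := eqVneq y 0; first by rewrite addr0.
have [->|xy0] := eqVneq (x + y) 0; first by move=> _ _; exact: ord_ge_zero.
have [n1 [d1 [d10 xE]]] := padic_fracP x.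
have [n2 [d2 [d20 yE]]] := padic_fracP y.
have d12 : d1 * d2 != 0 by rewrite mulf_neq0.
have fracMr (n d e : Zp) : e != 0 -> n%:F / d%:F = (n * e)%:F / (d * e)%:F.
  by move=> e0; rewrite !tofracM -mulf_div divff ?tofrac_eq0 // mulr1.
have xE' : x = (n1 * d2)%:F / (d1 * d2)%:F by rewrite xE (fracMr _ _ d2).
have yE' : y = (n2 * d1)%:F / (d1 * d2)%:F.
  by rewrite yE (fracMr _ _ d1) // (mulrC d2 d1).
have xyE : x + y = (n1 * d2 + n2 * d1)%:F / (d1 * d2)%:F.
  by rewrite xE' yE' -mulrDl -tofracD.
have nz (n d : Zp) z : z = n%:F / d%:F -> z != 0 -> n != 0.
  by move=> ->; apply: contraNneq => ->; rewrite tofrac0 mul0r.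
have N1 := nz _ _ _ xE' x0; have N2 := nz _ _ _ yE' y0.
have N := nz _ _ _ xyE xy0.
rewrite xyE xE' yE' !ord_ge_frac //.
have := padic_int_ordD N1 N2 N; rewrite geq_min => /orP[] le.
- by move=> h _; apply: le_trans h _; rewrite lerB // ler_nat.
- by move=> _ h; apply: le_trans h _; rewrite lerB // ler_nat.
Qed.

Lemma ord_ge_sum (I : Type) (l : seq I) (P : pred I) (F : I -> Qp) r :
  (forall i, P i -> ord_ge (F i) r) -> ord_ge (\sum_(i <- l | P i) F i) r.
Proof.
by move=> h; elim/big_ind: _ => //; [exact: ord_ge_zero|move=> ? ?; exact: ord_geD].
Qed.

Lemma ord_geM x y r s : ord_ge x r -> ord_ge y s -> ord_ge (x * y) (r + s).
Proof.
have [->|x0] := eqVneq x 0; first by rewrite mul0r => _ _; exact: ord_ge_zero.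
have [->|y0] := eqVneq y 0; first by rewrite mulr0 => _ _; exact: ord_ge_zero.
have [n1 [d1 [d10 xE]]] := padic_fracP x.
have [n2 [d2 [d20 yE]]] := padic_fracP y.
have n10 : n1 != 0 by apply: contra_neq x0 => n0; rewrite xE n0 tofrac0 mul0r.
have n20 : n2 != 0 by apply: contra_neq y0 => n0; rewrite yE n0 tofrac0 mul0r.
have [n0 nE] := padic_int_ordM n10 n20; have [d0 dE] := padic_int_ordM d10 d20.
have -> : x * y = (n1 * n2)%:F / (d1 * d2)%:F by rewrite xE yE mulf_div -!tofracM.
rewrite xE yE !ord_ge_frac // nE dE !natrD.
by lra.
Qed.

Lemma ord_ge_int (n : Zp) : ord_ge n%:F 0.
Proof.
have [->|n0] := eqVneq n 0; first by rewrite tofrac0; exact: ord_ge_zero.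
have o1 : padic_int_ord (1 : Zp) = 0%N.
  apply/eqP; rewrite -leqn0 leqNgt -padic_int_ordP ?oner_neq0 //=.
  by rewrite expn1 modn_small // prime_gt1.
rewrite -[n%:F]divr1 -tofrac1 ord_ge_frac ?oner_neq0 // o1 subr0.
by rewrite ler0n.
Qed.

Lemma ord_geX x r k : ord_ge x r -> ord_ge (x ^+ k) (k%:R * r).
Proof.
move=> h; elim: k => [|k IH]; first by rewrite mul0r expr0 -tofrac1; exact: ord_ge_int.
by rewrite exprS -natr1 mulrDl mul1r addrC; exact: ord_geM.
Qed.

Lemma ord_geN x r : ord_ge x r -> ord_ge (- x) r.
Proof.
move=> h; rewrite -mulN1r -[r]add0r; apply: ord_geM => //.
by rewrite -tofrac1 -tofracN; exact: ord_ge_int.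
Qed.

Lemma ord_geB x y r : ord_ge x r -> ord_ge y r -> ord_ge (x - y) r.
Proof. by move=> hx hy; apply: ord_geD => //; exact: ord_geN. Qed.

(** Quantifying over all lower bounds [s] expresses ord(x) <= r without extended values. *)
Lemma ord_geV x r : (forall s, ord_ge x s -> s <= r) -> ord_ge x^-1 (- r).
Proof.
have [->|x0] := eqVneq x 0; first by rewrite invr0 => _; exact: ord_ge_zero.
have [n [d [d0 xE]]] := padic_fracP x.
have n0 : n != 0 by apply: contra_neq x0 => n0; rewrite xE n0 tofrac0 mul0r.
move=> /(_ ((padic_int_ord n)%:R - (padic_int_ord d)%:R)).
rewrite xE invf_div !ord_ge_frac // => /(_ (lexx _)) => h.
by lra.
Qed.

(** * Units of Z_p and integrality *)

(** By Euler's theorem, n^(p^k (p - 1) - 1) inverts n modulo p^k; these residues are compatible and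
    define the inverse. *)
Lemma padic_unit1 (n : Zp) : n 1%N != 0%N -> exists m, m * n = 1.
Proof.
move=> n1.
have cop k : coprime (n k.+1) (p ^ k.+1).
  have e : (n k.+1 %% p)%N = n 1%N by rewrite -(residue_le n (ltn0Sn k)) expn1.
  have n1p : (n 1%N < p)%N by have := residue_lt n 1; rewrite expn1.
  rewrite coprime_pexpr // coprime_sym -coprime_modr e.
  by rewrite prime_coprime // gtnNdvd ?lt0n.
have euler k j : (p ^ k * p.-1 %| j)%N -> (n k.+1 ^ j = 1 %[mod p ^ k.+1])%N.
  move=> /dvdnP[q ->]; rewrite mulnC expnM -modnXm mulnC.
  by rewrite -(totient_pfactor pP (ltn0Sn k)) Euler_exp_totient // modnXm exp1n.
have hm k : (n k.+1 ^ (p ^ k.+1 * p.-1).-1 %% p ^ k.+1 %% p ^ k)%N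
    = (n k ^ (p ^ k * p.-1).-1 %% p ^ k)%N.
  rewrite natr_subproof -modnXm residueP; case: k => [|k]; first by rewrite !modn1.
  (* The exponents at consecutive levels differ by a multiple of the totient of p^(k+1). *)
  have -> : ((p ^ k.+2 * p.-1).-1
             = (p ^ k.+1 * p.-1).-1 + p ^ k.+1 * p.-1 * p.-1)%N.
    have pp : (0 < p ^ k.+1 * p.-1)%N.
      by rewrite muln_gt0 expn_gt0 prime_gt0 // -subn1 subn_gt0 prime_gt1.
    have : (p ^ k.+2 * p.-1 = p ^ k.+1 * p.-1 + p ^ k.+1 * p.-1 * p.-1)%N.
      by rewrite -mulnS prednK ?prime_gt0 // expnSr mulnAC.
    by move: (p ^ k.+1 * p.-1)%N pp => A A0 ->; case: A A0.
  rewrite expnD -modnMmr euler ?modnMmr ?muln1 //.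
  by rewrite dvdn_mulr // dvdn_mul // dvdn_exp2l.
exists (PadicInt pP hm); apply: padic_int_eq => -[|k]; rewrite residueM /= ?modn1 //.
rewrite modnMml -expnSr prednK; first by rewrite euler // dvdn_mul // dvdn_exp2l.
by rewrite muln_gt0 expn_gt0 prime_gt0 // -subn1 subn_gt0 prime_gt1.
Qed.

(** Cancelling p^k with k = ord(d) leaves a denominator [d'] that is nonzero modulo p, hence a unit;
    otherwise d would vanish modulo p^(k+1). *)
Lemma ord_ge0_is_padic_int x : ord_ge x 0 -> is_padic_int x.
Proof.
have [->|x0] := eqVneq x 0; first by exists 0; rewrite tofrac0.
have [n [d [d0 xE]]] := padic_fracP x.
have n0 : n != 0 by apply: contra_neq x0 => n0; rewrite xE n0 tofrac0 mul0r.
rewrite xE ord_ge_frac // subr_ge0 ler_nat => dn.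
set k := padic_int_ord d in dn.
have /padic_dvdP[n' nE] : n k = 0%N by apply/eqP; rewrite padic_int_ordP.
have /padic_dvdP[d' dE] : d k = 0%N by apply/eqP; rewrite padic_int_ordP.
have [u ud] : exists u, u * d' = 1.
  apply: padic_unit1; apply/negP => /eqP h.
  have /padic_dvdP[e eE] : d' 1%N = 0%N by [].
  have /eqP : d k.+1 = 0%N.
    by apply/padic_dvdP; exists e; rewrite dE eE mulrA -exprD addn1.
  by rewrite padic_int_ordP // ltnn.
exists (n' * u); apply: (canLR (mulfK _)); first by rewrite tofrac_eq0.
by rewrite -tofracM nE dE; congr _%:F; rewrite mulrACA -[n' in LHS]mulr1 -ud; ring.
Qed.

(** * Orders of natural numbers and of factorials *)

Lemma padic_natr_neq0 k : (0 < k)%N -> (k%:R : Zp) != 0.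
Proof.
move=> k0; apply/eqP => /(congr1 (fun x : Zp => x k)).
have -> : (0 : Zp) k = 0%N by rewrite -[LHS]/(0 %% p ^ k)%N mod0n.
rewrite residue_natr modn_small; last exact: ltn_expl (prime_gt1 pP).
by move=> e; rewrite e in k0.
Qed.

Lemma padic_int_ord_natr k : (0 < k)%N -> padic_int_ord (k%:R : Zp) = logn p k.
Proof.
move=> k0; have h n : (n <= padic_int_ord (k%:R : Zp))%N = (n <= logn p k)%N.
  by rewrite -padic_int_ordP ?padic_natr_neq0 // residue_natr -pfactor_dvdn.
by apply/eqP; rewrite eqn_leq -h leqnn h leqnn.
Qed.

Lemma ord_ge_natr k r : (0 < k)%N -> ord_ge (k%:R : Qp) r <-> r <= (logn p k)%:R.
Proof.
move=> k0; have -> : (k%:R : Qp) = (k%:R : Zp)%:F / (1%N%:R : Zp)%:F.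
  by rewrite tofrac1 divr1 tofracMn tofrac1.
rewrite ord_ge_frac ?padic_natr_neq0 // !padic_int_ord_natr // logn1 subr0.
by [].
Qed.

Lemma ord_ge_invn k : (0 < k)%N -> ord_ge (k%:R^-1 : Qp) (- (logn p k)%:R).
Proof. by move=> k0; apply: ord_geV => s; rewrite ord_ge_natr. Qed.

Lemma ord_ge_p : ord_ge (p%:R : Qp) 1.
Proof. by rewrite ord_ge_natr ?prime_gt0 // -{2}[p]expn1 pfactorK. Qed.

Lemma ord_ge_pM (n : Zp) : ord_ge (p%:R * n)%:F 1.
Proof.
rewrite tofracM tofracMn tofrac1 -[X in ord_ge _ X]addr0.
by apply: ord_geM; [exact: ord_ge_p|exact: ord_ge_int].
Qed.

(** With e = ord(k), p^e <= k, and e (p - 1) < p^e by induction on e. Strictness is what yields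
    ord(k) <= (k - 1) / (p - 1). *)
Lemma logn_le k : (0 < k)%N -> (logn p k * p.-1 < k)%N.
Proof.
move=> k0; apply: leq_trans (dvdn_leq k0 (pfactor_dvdnn p k)).
elim: (logn p k) => [|e IH]; first by rewrite mul0n.
have pe : (0 < p ^ e)%N by rewrite expn_gt0 prime_gt0.
rewrite mulSn expnS -[X in (_ <= X * _)%N](prednK (prime_gt0 pP)) mulSn addnC.
by have := leq_mul2l p.-1 1 (p ^ e); rewrite pe orbT muln1; lia.
Qed.

(** Legendre's formula, summed by telescoping: keeping the term n %/ p^N in the induction pays for
    the next summand, since p (n %/ p^(N+1)) <= n %/ p^N. *)
Lemma logn_fact_le n : (logn p n`! * p.-1 <= n)%N.
Proof.
have h N : ((\sum_(1 <= k < N.+1) n %/ p ^ k) * p.-1 + n %/ p ^ N <= n)%N.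
  elim: N => [|N IH]; first by rewrite big_geq // expn0 divn1 mul0n.
  apply: leq_trans IH; rewrite big_nat_recr //= mulnDl -addnA leq_add2l.
  rewrite -mulnSr prednK ?prime_gt0 // expnSr divnMA; exact: leq_divM.
by rewrite logn_fact //; apply: leq_trans (h n); rewrite leq_addr.
Qed.

(** * Order bounds under p-adic limits *)

Lemma padic_cvg_ord_ge (u : nat -> Qp) l v r :
  padic_cvg u l -> (exists N, forall n, (N <= n)%N -> ord_ge (u n - v) r) ->
  ord_ge (l - v) r.
Proof.
move=> ul [N hN]; have [B rB] : exists B : nat, r <= B%:R.
  by exists (Num.truncn r).+1; apply/ltW; rewrite truncnS_gt.
have [M hM] := ul B.
have -> : l - v = (u (maxn N M) - v) - (u (maxn N M) - l) by ring.
apply: ord_geB; first by apply: hN; rewrite leq_maxl.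
by apply: ord_ge_le rB _; apply: hM; rewrite leq_maxr.
Qed.

End PadicOrdTheory.

(** * Estimates in terms of c_p *)

Section KernelOrd.
Set Implicit Arguments.
Unset Strict Implicit.
Context (p : nat) (pP : prime p).
Local Notation Zp := (padic_int pP).
Local Notation Qp := (padic pP).
Local Notation c := (c_ p).

(** Here [1 - c] is 1 / (p - 1); phrasing the bound in [c] frees the later estimates from
    division. *)
Lemma logn_le_c k : (0 < k)%N -> (logn p k)%:R <= (k%:R - 1) * (1 - c) :> rat.
Proof.
move=> k0; have := logn_le pP k0; rewrite -(ler_nat rat) -natr1 natrM.
have p1 : 0 < p%:R - 1 :> rat by rewrite subr_gt0 ltr1n prime_gt1.
rewrite -subn1 natrB ?prime_gt0 // /c_ => h.
by rewrite subKr ler_pdivlMr //; lra.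
Qed.

Lemma logn_fact_le_c n : (logn p n`!)%:R <= n%:R * (1 - c) :> rat.
Proof.
have := logn_fact_le pP n; rewrite -(ler_nat rat) natrM.
have p1 : 0 < p%:R - 1 :> rat by rewrite subr_gt0 ltr1n prime_gt1.
rewrite -subn1 natrB ?prime_gt0 // /c_ => h.
by rewrite subKr ler_pdivlMr.
Qed.

Lemma c_ge0 : 0 <= c.
Proof.
have p2 : 2%:R <= p%:R :> rat by rewrite ler_nat prime_gt1.
by rewrite /c_ subr_ge0 invf_le1; lra.
Qed.

(** An odd prime is at least 3. The bound makes i c tend to infinity and the first term of log gamma
    dominate. *)
Lemma c_ge_half : odd p -> 1 / 2%:R <= c.
Proof.
move=> po; have p3 : (2 < p)%N by exact: odd_prime_gt2.
have p3' : 3%:R <= p%:R :> rat by rewrite ler_nat.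
have : (p%:R - 1)^-1 <= 2%:R^-1 :> rat by rewrite lef_pV2 ?posrE; lra.
by rewrite /c_; lra.
Qed.

(** * Coefficients of the logarithm series *)

Lemma coef_linearX (x y : Qp) k i :
  ((x%:P + y *: 'X) ^+ k)`_i = x ^+ (k - i) * y ^+ i *+ 'C(k, i).
Proof.
rewrite exprDn coef_sum.
have e j : ((x%:P ^+ (k - j) * (y *: 'X) ^+ j) *+ 'C(k, j))`_i
    = (x ^+ (k - j) * y ^+ j *+ 'C(k, j)) *+ (i == j).
  rewrite coefMn -polyC_exp coefCM exprZn coefZ coefXn.
  by case: eqP => _; rewrite ?mulr1 // !mulr0 mul0rn.
have [ik|ki] := leqP i k.
  rewrite (bigD1 (Ordinal (ik : (i < k.+1)%N))) //= e eqxx big1 ?addr0 //.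
  by move=> j ji; rewrite e; case: (i =P j) => // ij; case/eqP: ji; exact: val_inj.
rewrite bin_small // mulr0n big1 // => j _; rewrite e.
by rewrite gtn_eqF // (leq_trans (ltn_ord j)).
Qed.

(* Since C(k, i) / k = C(k - 1, i - 1) / i, only ord(i) is lost for i > 0.    *)
Lemma log_term_ord_ge (x y : Zp) k i : (0 < k)%N ->
  ord_ge (((-1) ^+ k.+1 / k%:R *:
    ((p%:R * x)%:F%:P + (p%:R * y)%:F *: 'X) ^+ k)`_i) (i.-1%:R * c + 1).
Proof.
move=> k0; rewrite coefZ coef_linearX -mulrA -[_ + 1]add0r.
apply: ord_geM.
  by rewrite -tofrac1 -tofracN -tofracXn; exact: ord_ge_int.
have [ik|ki] := leqP i k; last first.
  by rewrite bin_small // mulr0n mulr0; exact: ord_ge_zero.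
set q := _ * _ ^+ i.
have hq : ord_ge q k%:R.
  rewrite -(subnK ik) natrD /q.
  by apply: ord_geM; rewrite -[X in ord_ge _ X]mulr1; apply: ord_geX; exact: ord_ge_pM.
have kn0 : (k%:R : Qp) != 0.
  by rewrite -tofrac1 -tofracMn tofrac_eq0 padic_natr_neq0.
(* For i = 0 all of ord(k) is lost, but k - ord(k) >= 1 + (k - 1) c >= 1 suffices, as [0.-1] is
   0. *)
case: i ik @q hq => [|i] ik q hq.
  have lk := logn_le_c k0.
  have kc : 0 <= (k%:R - 1) * c by rewrite mulr_ge0 ?c_ge0 // subr_ge0 ler1n.
  rewrite bin0 mulr1n; apply: ord_ge_le (ord_geM (ord_ge_invn pP k0) hq).
  by rewrite /= mul0r; lra.
have in0 : (i.+1%:R : Qp) != 0.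
  by rewrite -tofrac1 -tofracMn tofrac_eq0 padic_natr_neq0.
have -> : k%:R^-1 * (q *+ 'C(k, i.+1)) = i.+1%:R^-1 * (q * 'C(k.-1, i)%:R).
  have /(congr1 (fun n => n%:R : Qp)) := mul_bin_diag k i.
  rewrite !natrM -(mulr_natr q) => e.
  have -> : 'C(k, i.+1)%:R = i.+1%:R^-1 * (k%:R * 'C(k.-1, i)%:R) :> Qp.
    by rewrite e mulKf.
  by rewrite [q * (i.+1%:R^-1 * _)]mulrCA [q * (k%:R * _)]mulrCA mulrCA mulKf.
have hC : ord_ge ('C(k.-1, i)%:R : Qp) 0.
  by rewrite -tofrac1 -tofracMn; exact: ord_ge_int.
apply: ord_ge_le (ord_geM (ord_ge_invn pP (ltn0Sn i)) (ord_geM hq hC)).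
have := logn_le_c (ltn0Sn i); have : i.+1%:R <= k%:R :> rat by rewrite ler_nat.
by rewrite -[i.+1%:R]natr1 /=; lra.
Qed.

(* If the series did not converge, [tate_log] would be 0: either way the      *)
(* bound holds, so completeness of Q_p<z> is never needed.                    *)
Lemma tate_log_ord_ge (x y : Zp) i :
  ord_ge (tate_log ((1 + p%:R * x)%:F%:P + (p%:R * y)%:F *: 'X) i) (i.-1%:R * c + 1).
Proof.
rewrite /tate_log; case: xgetP => [l _ [_ lP]|_]; last exact: ord_ge_zero.
rewrite -[l i]subr0; set u := (fun n : nat => _) in lP.
apply: (padic_cvg_ord_ge (u := fun n => (u n)`_i)).
  by move=> B; have [N hN] := lP B; exists N => n /hN.
exists 0%N => n _; rewrite subr0 /u coef_sum big_nat_cond.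
apply: ord_ge_sum => k; rewrite andbT => /andP[k0 _].
rewrite addrAC -polyC1 -polyCB tofracD tofrac1 addrAC subrr add0r.
exact: log_term_ord_ge.
Qed.

(** * The order of log gamma *)

(** If gamma were 1 modulo p^2, so would be all its powers, and none would meet the class of 1 +
    p. *)
Lemma topological_generator_ord (gamma : Zp) r : topological_generator gamma ->
  ord_ge (gamma - 1)%:F r -> r <= 1.
Proof.
move=> [_ gen].
have g2 : (gamma - 1) 2%N != 0%N.
  apply/negP => /eqP g2.
  have p2 : (1 + p < p ^ 2)%N by have := prime_gt1 pP; nia.
  have one2 : (1 : Zp) 2%N = 1%N by rewrite /= modn_small //; lia.
  have gamma2 : gamma 2%N = 1%N.
    by rewrite -(subrK 1 gamma) residueD g2 one2 modn_small //; lia.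
  have gammaV2 : gamma^-1 2%N = 1%N.
    (* The inverse of a non-unit is by convention the element itself, whose residue is already
       known. *)
    have [u|/invr_out->//] := boolP (gamma \is a GRing.unit).
    have := congr1 (fun z : Zp => z 2%N) (mulVr u).
    by rewrite residueM gamma2 muln1 residue_mod one2.
  have gammaX2 (k : int) : (gamma ^ k) 2%N = 1%N.
    case: k => n; rewrite /exprz; last rewrite -exprVn.
      by rewrite residueX gamma2 exp1n modn_small //; lia.
    by rewrite residueX gammaV2 exp1n modn_small //; lia.
  have [|k] := gen (1 + p)%:R _ 2%N.
    by exists 1; rewrite natrD addrAC subrr add0r mulr1.
  by rewrite gammaX2 residue_natr modn_small //; have := prime_gt1 pP; lia.
have g0 : gamma - 1 != 0 by apply: contraNneq g2 => ->; rewrite /= mod0n.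
have o1 : (padic_int_ord (gamma - 1)%R <= 1)%N.
  by rewrite leqNgt -padic_int_ordP.
have -> : (gamma - 1)%:F = (gamma - 1)%:F / (1%N%:R : Zp)%:F by rewrite tofrac1 divr1.
rewrite ord_ge_frac ?oner_neq0 // padic_int_ord_natr // logn1 subr0 => h.
by apply: le_trans h _; rewrite lern1.
Qed.

(** For k >= 2 the k-th term of the logarithm has order at least 1 + (k - 1) c >= 1 + c, so log
    gamma agrees with gamma - 1 beyond order 1. *)
Lemma padic_log_invr_ord_ge (gamma : Zp) : odd p -> topological_generator gamma ->
  ord_ge (padic_log gamma%:F)^-1 (-1).
Proof.
(* Without a limit the logarithm defaults to 0, whose inverse is 0. *)
move=> po gen; rewrite /padic_log; case: xgetP => [l _ lP|_]; last first.
  by rewrite invr0; exact: ord_ge_zero.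
have [[y gE] _] := gen.
have c2 := c_ge_half po.
have hl : ord_ge (l - (gamma - 1)%:F) (1 + c).
  apply: padic_cvg_ord_ge lP _; exists 2%N => n n2.
  rewrite big_ltn // big_nat_cond sqrrN expr1n divr1 mul1r expr1.
  rewrite tofracB tofrac1 addrAC subrr add0r.
  apply: ord_ge_sum => k; rewrite andbT => /andP[k2 _].
  rewrite -tofrac1 -tofracB gE -mulrA -[1 + c]add0r.
  apply: ord_geM.
    by rewrite tofrac1 -tofrac1 -tofracN -tofracXn; exact: ord_ge_int.
  have k0 : (0 < k)%N by exact: ltnW.
  have h := ord_geX k (ord_ge_pM y).
  apply: ord_ge_le (ord_geM (ord_ge_invn pP k0) h).
  have := logn_le_c k0; have : 2%:R <= k%:R :> rat by rewrite ler_nat.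
  by nra.
(* A bound s > 1 for log gamma would give gamma - 1 order at least min(s, 1 + c) > 1. *)
apply: ord_geV => s ls; rewrite leNgt; apply/negP => s1.
have : ord_ge (gamma - 1)%:F (Num.min s (1 + c)).
  rewrite -[_%:F](subKr l).
  by apply: ord_geB; [apply: ord_ge_le ls|apply: ord_ge_le hl];
    rewrite ge_min lexx ?orbT.
by move=> /(topological_generator_ord gen); rewrite leNgt lt_min s1 /=; lra.
Qed.

(** * The series log_gamma((a + bz) / omega(a)) and its binomials *)

(** As a / omega(a) is 1 modulo p, the argument has the form 1 + px + py'z treated by
    [tate_log_ord_ge]; dividing by log gamma costs the extra 1. *)
Lemma log_gamma_series_ord_ge (gamma a b : Zp) i : odd p ->
  topological_generator gamma -> a \is a GRing.unit -> in_pZp b ->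
  ord_ge (log_gamma_series gamma a b i) (i.-1%:R * c).
Proof.
move=> po gen ua [y bE].
have [wX w1] := teichmullerP ua; set w := teichmuller a in wX w1.
have pp : (0 < p.-1)%N by rewrite -subn1 subn_gt0 prime_gt1.
have uw : w \is a GRing.unit by rewrite -(unitrX_pos _ pp) wX unitr1.
have wV : w%:F^-1 = (w^-1)%:F.
  have w0 : w%:F != 0 by rewrite tofrac_eq0; apply: contraTneq uw => ->; rewrite unitr0.
  by apply: (mulfI w0); rewrite mulfV // -tofracM divrr // tofrac1.
have [x xE] : exists x, w^-1 * a - 1 = p%:R ^+ 1 * x.
  apply/padic_dvdP; rewrite -(mulVr uw) -mulrBr residueM.
  suff -> : (a - w) 1%N = 0%N by rewrite muln0 mod0n.
  rewrite residueD.
  have -> : ((- w) 1%N = (p ^ 1 - w 1%N) %% p ^ 1)%N by [].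
  by rewrite w1 modnDmr subnKC ?modnn // ltnW // residue_lt.
have := tate_log_ord_ge x (w^-1 * y) i.
have -> : (1 + p%:R * x)%:F%:P + (p%:R * (w^-1 * y))%:F *: 'X
    = w%:F^-1 *: (a%:F%:P + b%:F *: 'X) :> {poly Qp}.
  rewrite -[p%:R * x]/(p%:R ^+ 1 * x) -xE [1 + _]addrC subrK wV bE scalerDr scalerA.
  by rewrite -[_ *: _%:P]mul_polyC -polyCM -!tofracM mulrCA.
move=> h; rewrite -[_ * c](addrK 1).
by apply: ord_geM => //; exact: padic_log_invr_ord_ge.
Qed.

(** In a Cauchy product the degrees add up to i, so the slope [r] is kept while each factor
    contributes one [s]. *)
Lemma series_prod_ord_ge (F : nat -> nat -> Qp) n (r s : rat) :
  (forall k i, ord_ge (F k i) (i%:R * r + s)) ->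
  forall i, ord_ge ((\big[@series_mul p pP/series_const 1]_(k < n) F k) i)
    (i%:R * r + n%:R * s).
Proof.
elim: n F => [|n IH] F hF i.
  rewrite big_ord0 /series_const; case: eqP => [->|_]; last exact: ord_ge_zero.
  by rewrite !mul0r addr0 -tofrac1; exact: ord_ge_int.
rewrite big_ord_recl; apply: ord_ge_sum => j _.
have := IH (fun k => F k.+1) (fun k => hF k.+1) (i - j)%N => h.
apply: ord_ge_le (ord_geM (hF 0%N j) h).
have ji : (j <= i)%N by rewrite -ltnS.
by rewrite natrB // -[n.+1%:R]natr1; lra.
Qed.

(** Subtracting the integer k only affects the constant term, which is harmless as s <= 0; dividing
    by n! costs at most n (1 - c). *)
Lemma series_binom_ord_ge (f : nat -> Qp) (r s : rat) : s <= 0 ->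
  (forall i, ord_ge (f i) (i%:R * r + s)) ->
  forall n i, ord_ge (series_binom f n i) (i%:R * r + n%:R * (s - (1 - c))).
Proof.
move=> s0 hf n i; rewrite /series_binom mulrBr addrA.
apply: ord_geM; last first.
  apply: ord_ge_le (ord_ge_invn pP (fact_gt0 n)); rewrite lerN2.
  exact: logn_fact_le_c.
apply: (@series_prod_ord_ge (fun k i' => f i' - series_const k%:R i') n r s) => k j.
apply: ord_geB => //; rewrite /series_const.
case: eqP => [->|_]; last exact: ord_ge_zero.
rewrite mul0r add0r; apply: ord_ge_le s0 _.
by rewrite -tofrac1 -tofracMn; exact: ord_ge_int.
Qed.

Lemma padic_cvg0_linear (f : nat -> Qp) : odd p ->
  (forall n, ord_ge (f n) (n%:R * c)) -> padic_cvg f 0.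
Proof.
(* The factor 2 comes from c >= 1/2. *)
move=> po hf B; exists (2 * B)%N => n nB; rewrite subr0; apply: ord_ge_le (hf n).
have := c_ge_half po; move: nB; rewrite -(ler_nat rat) natrM.
by have : 0 <= B%:R :> rat by []; nra.
Qed.

(** * Order bounds for the kernel *)

Lemma K_coef_ord_ge (gamma a b : Zp) m i j : odd p ->
  topological_generator gamma -> a \is a GRing.unit -> in_pZp b ->
  ord_ge (K_coef gamma a b m i j) (i%:R * c) /\
  ord_ge (K_coef gamma a b m i j) (j%:R * c).
Proof.
move=> po gen ua pb.
have hL k : ord_ge (log_gamma_series gamma a b k) (k.-1%:R * c).
  exact: log_gamma_series_ord_ge.
(* The binomial gives i r + j (s - (1 - c)), and p^j adds j. Two choices of (r, s) yield the two
   bounds. *)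
have K_ge r s : s <= 0 -> (forall k, k%:R * r + s <= k.-1%:R * c) ->
    ord_ge (K_coef gamma a b m i j) (i%:R * r + j%:R * (s + c)).
  move=> s0 le.
  have hb := series_binom_ord_ge s0 (fun k => ord_ge_le (le k) (hL k)) j i.
  rewrite /K_coef -tofracXn -[_ + _]add0r; apply: ord_geM; first exact: ord_ge_int.
  apply: ord_ge_le (ord_geM hb (ord_geX j (ord_ge_p pP))).
  by lra.
have c0 := c_ge0; split.
(* The line (k - 1) c has s = -c, which cancels the j-part exactly. *)
- have := K_ge c (- c); rewrite addNr mulr0 addr0; apply; first by rewrite oppr_le0.
  by case=> [|k] /=; [lra|rewrite -natr1; lra].
(* Mere integrality of the factors leaves the j-part whole. *)
- have := K_ge 0 0; rewrite mulr0 !add0r; apply => // k.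
  by rewrite mulr0 addr0 mulr_ge0.
Qed.

End KernelOrd.

Theorem theorem2p15 (p : nat) (pP : prime p) (p_odd : odd p)
    (gamma : padic_int pP) (gamma_gen : topological_generator gamma)
    (m : nat) (m_le : (m <= p - 2)%N)
    (a c : padic_int pP) (a_unit : a \is a GRing.unit) (c_pZp : in_pZp c) :
  in_S_tensor_Zp (K_coef gamma a c m) /\
  (forall j, in_S (fun i => K_coef gamma a c m i j)) /\
  (forall i j, is_padic_int (K_coef gamma a c m i j) /\
     ord_ge (K_coef gamma a c m i j) (i%:R * c_ p)).
Proof.
have hK i j := K_coef_ord_ge m i j p_odd gamma_gen a_unit c_pZp.
have KS j : in_S (fun i => K_coef gamma a c m i j).
  have h i := proj1 (hK i j); split => //; exact: padic_cvg0_linear.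
split; last split => //; last first.
  move=> i j; have h := proj1 (hK i j); split => //; apply: ord_ge0_is_padic_int.
  by apply: ord_ge_le h; rewrite mulr_ge0 ?c_ge0.
(* Truncate in w, with t_k = w^k: the coefficients dropped have j >= 2B, hence order at least j c >=
   B for every i. *)
move=> B; exists (2 * B)%N, (fun k i => K_coef gamma a c m i k).
exists (fun k j => (j == k :> nat)%:R); split => // [k|i j].
  split => [N|n]; last by exists ((n == k :> nat)%:R); rewrite tofracMn tofrac1.
  by exists k.+1 => n kn; rewrite gtn_eqF // subrr; exact: ord_ge_zero.
have [jB|Bj] := ltnP j (2 * B).
  rewrite (bigD1 (Ordinal jB)) //= eqxx mulr1 big1 ?addr0 ?subrr.
    exact: ord_ge_zero.
  move=> k kj; case: (j =P k) => [jk|_]; last by rewrite mulr0.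
  by case/eqP: kj; exact: val_inj.
rewrite big1 ?subr0 => [|k _]; last by rewrite gtn_eqF ?mulr0 // (leq_trans (ltn_ord k)).
apply: ord_ge_le (proj2 (hK i j)).
have := c_ge_half pP p_odd; move: Bj; rewrite -(ler_nat rat) natrM.
by have : 0 <= B%:R :> rat by []; nra.
Qed.
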